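(* Let $T$ be a complete countable first-order theory, $\mathcal{B}$ a complete Boolean algebra, $\mathcal{U}$ an ultrafilter on $\mathcal{B}$, $\mathbf{M}\models^{\mathcal{B}}T$, and $p(\overline{x})$ a partial type over $\mathbf{M}$. The following are equivalent: (A) There is a full $\mathcal{B}$-valued structure $\mathbf{N}\succeq\mathbf{M}$ such that $\mathbf{N}/\mathcal{U}$ contains a realization of $[p(\overline{x})]_{\mathcal{U}}$. (B) The Łoś map $\mathbf{L}_{p(\overline{x})}$ has a multiplicative refinement in $\mathcal{U}$.
   Context: A full $\mathcal{B}$-valued structure $\mathbf{M}$ is a set with a map $\|\cdot\|_{\mathbf{M}}$ from formulas with parameters in $\mathbf{M}$ to $\mathcal{B}$ such that valid sentences get $1$, $\|\neg\varphi\|=\neg\|\varphi\|$, $\|\varphi\wedge\psi\|=\|\varphi\|\wedge\|\psi\|$, $\|\exists x\varphi(x)\|=\bigvee_{a}\|\varphi(a)\|$, $\|a=b\|<1$ for distinct $a,b$, and for each $\varphi(x)$ some $a$ has $\|\exists x\varphi(x)\|=\|\varphi(a)\|$; $\mathbf{M}\models^{\mathcal{B}}T$ means additionally $\|\varphi\|=1$ for $\varphi\in T$. $\mathbf{M}\preceq\mathbf{N}$ means $\mathbf{M}\subseteq\mathbf{N}$ and $\|\varphi(\overline{a})\|_{\mathbf{M}}=\|\varphi(\overline{a})\|_{\mathbf{N}}$ for all formulas with parameters in $\mathbf{M}$. The specialization $\mathbf{M}/\mathcal{U}$ is the ordinary structure with a surjection $[\cdot]_{\mathcal{U}}:\mathbf{M}\to\mathbf{M}/\mathcal{U}$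 such that $\|\varphi(\overline{a})\|_{\mathbf{M}}\in\mathcal{U}$ iff $\mathbf{M}/\mathcal{U}\models\varphi([\overline{a}]_{\mathcal{U}})$. A partial type over $\mathbf{M}$ is a set $p(\overline{x})$ of formulas in finitely many variables $\overline{x}$ with parameters from $\mathbf{M}$ such that $\|\exists\overline{x}\bigwedge\Gamma\|_{\mathbf{M}}>0$ for every finite $\Gamma\subseteq p$; $[p(\overline{x})]_{\mathcal{U}}$ is its image under $[\cdot]_{\mathcal{U}}$. For an index set $I$, an $I$-distribution in $\mathcal{B}$ is $\mathbf{A}:[I]^{<\aleph_0}\to\mathcal{B}\setminus\{0\}$ with $\mathbf{A}(\emptyset)=1$ and $s\subseteq t\Rightarrow\mathbf{A}(s)\ge\mathbf{A}(t)$; it is in $\mathcal{U}$ if its image is contained in $\mathcal{U}$; it is multiplicative if $\mathbf{A}(s)=\bigwedge_{i\in s}\mathbf{A}(\{i\})$ for all $s$; $\mathbf{B}$ refines $\mathbf{A}$ if $\mathbf{B}(s)\le\mathbf{A}(s)$ for all $s$. The Łoś map of $p$ is the $p(\overline{x})$-distribution $\mathbf{L}_{p(\overline{x})}(\Gamma)=\|\exists\overline{x}\bigwedge\Gamma(\overline{x})\|_{\mathbf{M}}$ for finite $\Gamma\subseteq p(\overline{x})$. *)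

(* Defs.v *)
From HB Require Import structures.
From mathcomp Require Import all_boot all_order finmap.
From mathcomp Require Import boolp classical_sets.

Set Implicit Arguments.
Unset Strict Implicit.
Unset Printing Implicit Defensive.

Local Open Scope classical_set_scope.
Local Open Scope fset_scope.
Local Open Scope order_scope.

(** First-order logic with equality over a countable language *)

Record language := Language {
  fsym : countType;
  rsym : countType;
  farity : fsym -> nat;
  rarity : rsym -> nat }.

Section Syntax.
Variable L : language.

(* Terms and formulas with parameters in [C] whose free variables are among
   [0, ..., n-1]. Bound variables are de Bruijn indices: [Ex] binds [ord0]. *)
Inductive term (C : Type) (n : nat) : Type :=
| Var of 'I_n
| Par of C
| App (f : fsym L) of ('I_(farity f) -> term C n).

Inductive formula (C : Type) : nat -> Type :=
| Eq n : term C n -> term C n -> formula C n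
| Rel n (r : rsym L) : ('I_(rarity r) -> term C n) -> formula C n
| Neg n : formula C n -> formula C n
| And n : formula C n -> formula C n -> formula C n
| Ex n : formula C n.+1 -> formula C n.

Definition sentence (C : Type) := formula C 0.

(* The Łoś map is indexed by finite sets of formulas, and [{fset _}] needs a
   choiceType; these instances are classical. *)
HB.instance Definition _ (C : Type) (n : nat) := gen_eqMixin (formula C n).
HB.instance Definition _ (C : Type) (n : nat) := gen_choiceMixin (formula C n).

Definition scons (X : Type) (n : nat) (x : X) (v : 'I_n -> X) : 'I_n.+1 -> X :=
  fun i => oapp v x (unlift ord0 i).

Definition snil (X : Type) : 'I_0 -> X.
Proof. by case. Defined.

Fixpoint tsubst (C : Type) (n m : nat) (s : 'I_n -> term C m) (t : term C n) :
    term C m :=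
  match t with
  | Var i => s i
  | Par c => Par m c
  | App f ts => App (fun i => tsubst s (ts i))
  end.

Definition lift_subst (C : Type) (n m : nat) (s : 'I_n -> term C m) :
    'I_n.+1 -> term C m.+1 :=
  scons (Var C ord0) (fun i => tsubst (fun j => Var C (lift ord0 j)) (s i)).

Fixpoint fsubst (C : Type) (n : nat) (phi : formula C n) :
    forall m : nat, ('I_n -> term C m) -> formula C m :=
  match phi in formula _ n return forall m, ('I_n -> term C m) -> formula C m with
  | Eq _ t u => fun m s => Eq (tsubst s t) (tsubst s u)
  | Rel _ r ts => fun m s => Rel (fun i => tsubst s (ts i))
  | Neg _ phi => fun m s => Neg (fsubst phi s)
  | And _ phi psi => fun m s => And (fsubst phi s) (fsubst psi s)
  | Ex _ phi => fun m s => Ex (fsubst phi (lift_subst s))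
  end.

Definition inst (C : Type) (n : nat) (phi : formula C n.+1) (a : C) :
    formula C n :=
  fsubst phi (scons (Par n a) (@Var C n)).

Fixpoint tmap (C D : Type) (h : C -> D) (n : nat) (t : term C n) : term D n :=
  match t with
  | Var i => Var D i
  | Par c => Par n (h c)
  | App f ts => App (fun i => tmap h (ts i))
  end.

Fixpoint fmap (C D : Type) (h : C -> D) (n : nat) (phi : formula C n) :
    formula D n :=
  match phi with
  | Eq _ t u => Eq (tmap h t) (tmap h u)
  | Rel _ r ts => Rel (fun i => tmap h (ts i))
  | Neg _ phi => Neg (fmap h phi)
  | And _ phi psi => And (fmap h phi) (fmap h psi)
  | Ex _ phi => Ex (fmap h phi)
  end.

(* The empty conjunction is [exists x, x = x]. *)
Definition conj (C : Type) (n : nat) (s : seq (formula C n)) : formula C n :=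
  foldr (@And C n) (Ex (Eq (Var C ord0) (Var C ord0))) s.

Fixpoint exs (C : Type) (n : nat) : formula C n -> sentence C :=
  match n return formula C n -> sentence C with
  | 0 => fun phi => phi
  | _.+1 => fun phi => exs (Ex phi)
  end.

End Syntax.

Arguments fmap {L C D} h {n} phi.

Section Semantics.
Variable L : language.

Record structure := Structure {
  dom :> Type;
  dom_inhabited : inhabited dom;
  fint : forall f : fsym L, ('I_(farity f) -> dom) -> dom;
  rint : forall r : rsym L, ('I_(rarity r) -> dom) -> Prop }.

Fixpoint eval (S : structure) (C : Type) (e : C -> S) (n : nat)
    (v : 'I_n -> S) (t : term L C n) : S :=
  match t with
  | Var i => v i
  | Par c => e c
  | App f ts => fint (fun i => eval e v (ts i))
  end.

Fixpoint sat (S : structure) (C : Type) (e : C -> S) (n : nat)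
    (phi : formula L C n) : ('I_n -> S) -> Prop :=
  match phi in formula _ _ n return ('I_n -> S) -> Prop with
  | Eq _ t u => fun v => eval e v t = eval e v u
  | Rel _ r ts => fun v => rint (fun i => eval e v (ts i))
  | Neg _ phi => fun v => ~ sat e phi v
  | And _ phi psi => fun v => sat e phi v /\ sat e psi v
  | Ex _ phi => fun v => exists x : S, sat e phi (scons x v)
  end.

Definition models (S : structure) (C : Type) (e : C -> S) (phi : sentence L C) :
    Prop :=
  sat e phi (@snil S).

(* Validity of a sentence with parameters: the parameters are read as new
   constant symbols, so they may denote any elements. *)
Definition valid (C : Type) (phi : sentence L C) : Prop :=
  forall (S : structure) (e : C -> S), models e phi.

Definition theory := set (sentence L void).

Definition is_model (T : theory) (S : structure) : Prop :=
  forall phi, T phi -> models (of_void S) phi.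

Definition entails (T : theory) (phi : sentence L void) : Prop :=
  forall S : structure, is_model T S -> models (of_void S) phi.

Definition complete_theory (T : theory) : Prop :=
  (exists S : structure, is_model T S) /\
  forall phi, entails T phi \/ entails T (Neg phi).

End Semantics.

Section BooleanValued.
Variables (L : language) (d : Order.disp_t) (B : ctbDistrLatticeType d).

Definition complete_lattice : Prop := forall A : set B, supremums A !=set0.

Record ultrafilter (U : set B) : Prop := Ultrafilter {
  ultra_top : U \top;
  ultra_bot : ~ U \bot;
  ultra_meet : forall a b : B, U a -> U b -> U (a `&` b);
  ultra_up : forall a b : B, U a -> a <= b -> U b;
  ultra_compl : forall a : B, U a \/ U (~` a) }.

Record full_bvs := FullBvs {
  carrier :> Type;
  bval : sentence L carrier -> B;
  bval_valid : forall phi, valid phi -> bval phi = \top;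
  bval_neg : forall phi, bval (Neg phi) = ~` (bval phi);
  bval_and : forall phi psi, bval (And phi psi) = bval phi `&` bval psi;
  bval_ex : forall phi : formula L carrier 1,
    supremums (range (fun a => bval (inst phi a))) (bval (Ex phi));
  bval_eq : forall a b : carrier,
    a <> b -> bval (Eq (Par L 0 a) (Par L 0 b)) < \top;
  bval_full : forall phi : formula L carrier 1,
    exists a : carrier, bval (Ex phi) = bval (inst phi a) }.

Definition bv_models (M : full_bvs) (T : theory L) : Prop :=
  forall phi, T phi -> bval (fmap (of_void M) phi) = \top.

(* [M] is an elementary substructure of [N], the inclusion being [h]. *)
Definition elementary_inclusion (M N : full_bvs) (h : M -> N) : Prop :=
  injective h /\ forall phi : sentence L M, bval (fmap h phi) = bval phi.

(* [S] is the specialization of [M] at [U], with projection [pi]; this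
   determines [(S, pi)] up to isomorphism. *)
Definition is_specialization (U : set B) (M : full_bvs) (S : structure L)
    (pi : M -> S) : Prop :=
  (forall x : S, exists a : M, pi a = x) /\
  forall phi : sentence L M, U (bval phi) <-> models pi phi.

Definition realizes (S : structure L) (n : nat) (q : set (formula L S n))
    (b : 'I_n -> S) : Prop :=
  forall phi, q phi -> sat id phi b.

Section Distributions.
Variable I : choiceType.

Record distribution (A : {fset I} -> B) : Prop := Distribution {
  distr_pos : forall s, \bot < A s;
  distr_empty : A fset0 = \top;
  distr_anti : forall s t : {fset I}, (s `<=` t)%fset -> A t <= A s }.

Definition distr_in (U : set B) (A : {fset I} -> B) : Prop := forall s, U (A s).

Definition multiplicative (A : {fset I} -> B) : Prop :=
  forall s : {fset I}, A s = \meet_(i <- s) A [fset i].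

Definition refines (A' A : {fset I} -> B) : Prop := forall s, A' s <= A s.

End Distributions.

Definition los_map (M : full_bvs) (n : nat) (p : set (formula L M n))
    (G : {fset p}) : B :=
  bval (exs (conj [seq val phi | phi <- G])).

Definition partial_type (M : full_bvs) (n : nat) (p : set (formula L M n)) :
    Prop :=
  forall G : {fset p}, \bot < los_map G.

End BooleanValued.

Arguments los_map {L d B M n} p G.

(* Main.v *)
(* If N realizes the type at b, with representatives a, then the values
   ||phi(a)||_N generate a multiplicative refinement of the Los map in U.

   Conversely, let A be such a refinement. For an ultrafilter W on B and a
   finite G included in p, the ordinary structure M/W satisfies at some tuple
   all phi in G with A(phi) in W. In the product of the structures M/W over
   all pairs (W, G), formulas take values in the power set of the set of
   pairs. Monteiro's theorem (a map into a complete Boolean algebra that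
   preserves finite meets, 0 and 1 lies below a Boolean homomorphism) gives a
   homomorphism r from this power set to B that sends {(W, G) | b in W} to b
   and {(W, G) | phi in G} to 1. Composing values with r turns the product
   into a full B-valued elementary extension of M in which the tuples found
   above satisfy phi with value at least A(phi). *)
From mathcomp Require Import filter.
Require Import Defs.
From mathcomp Require Import all_boot all_order finmap.
From mathcomp Require Import boolp classical_sets.

Set Implicit Arguments.
Unset Strict Implicit.
Unset Printing Implicit Defensive.

Local Open Scope classical_set_scope.

(** * Extending meet-preserving maps to Boolean homomorphisms *)

Section BooleanHomomorphisms.
Import Order.Theory.
Local Open Scope order_scope.

Definition meet_hom (d d' : Order.disp_t) (C : ctbDistrLatticeType d)
    (B : ctbDistrLatticeType d') (g : C -> B) : Prop :=
  [/\ g \bot = \bot, g \top = \top & {morph g : x y / x `&` y}].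

Definition bool_hom (d d' : Order.disp_t) (C : ctbDistrLatticeType d)
    (B : ctbDistrLatticeType d') (r : C -> B) : Prop :=
  meet_hom r /\ {morph r : x / ~` x}.

Lemma meet_hom_le (d d' : Order.disp_t) (C : ctbDistrLatticeType d)
    (B : ctbDistrLatticeType d') (g : C -> B) :
  meet_hom g -> {homo g : x y / x <= y}.
Proof. by case=> _ _ gM x y /meet_idPl xy; rewrite -xy gM leIr. Qed.

Lemma leI_compl (d : Order.disp_t) (B : ctbDistrLatticeType d) (x y z : B) :
  (x `&` y <= z) = (x <= ~` y `|` z).
Proof. by rewrite -leBLR diffE complK. Qed.

(** Infinite distributivity in both arguments: meeting with a fixed element is left adjoint to
    implication, so the two suprema can be removed in turn. *)
Lemma supremums_meet_le (d : Order.disp_t) (B : ctbDistrLatticeType d)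
    (X Y : set B) (a b z : B) :
  supremums X a -> supremums Y b ->
  (forall x y, X x -> Y y -> x `&` y <= z) -> a `&` b <= z.
Proof.
move=> [_ aX] [_ bY] XYz; rewrite leI_compl; apply: aX => x Xx.
rewrite -leI_compl meetC leI_compl; apply: bY => y Yy.
by rewrite -leI_compl meetC XYz.
Qed.

Lemma bool_complete : complete_lattice bool.
Proof.
move=> A; exists `[< A true >]; split.
  by case=> // At; rewrite (asboolT At).
move=> b Ab; case: asboolP => // At; exact: Ab.
Qed.

Variables (d d' : Order.disp_t) (C : ctbDistrLatticeType d)
  (B : ctbDistrLatticeType d').

(** The new map agrees with [g y] below [g (~ x)] and with [g (~ x | y)] below its complement; both
    pieces preserve meets, and the second vanishes at 0. It dominates [g] and raises the value at
    [x] to at least the complement of [g (~ x)]. *)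
Lemma meet_hom_extend (g : C -> B) (x : C) : meet_hom g ->
  meet_hom (fun y => (g y `|` ~` g (~` x)) `&` g (~` x `|` y)).
Proof.
case=> g0 g1 gM; split; first by rewrite g0 join0x joinx0 meetCx.
  by rewrite g1 joinx1 g1 join1x meetx1.
by move=> y z; rewrite gM joinIl joinIr gM meetACA.
Qed.

(** By Zorn's lemma there is a maximal meet-preserving map above [g]. If it failed to preserve a
    complement, [meet_hom_extend] would enlarge it. *)
Lemma meet_hom_below_bool_hom (g : C -> B) : complete_lattice B ->
  meet_hom g -> exists2 r : C -> B, bool_hom r & forall x, g x <= r x.
Proof.
move=> B_complete gH.
pose T := {f : C -> B | meet_hom f /\ forall x, g x <= f x}.
pose R (f f' : T) := `[< forall x, sval f x <= sval f' x >].
pose g0 : T := exist _ g (Logic.conj gH (fun x => lexx (g x))).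
have Rle f f' : reflect (forall x, sval f x <= sval f' x) (R f f').
  exact: asboolP.
have [||||[r [rH gr]] rmax] := @Zorn T R.
- by move=> f; apply/Rle => x; exact: lexx.
- by move=> f1 f2 f3 /Rle f12 /Rle f23; apply/Rle => x; exact: le_trans (f23 x).
- move=> [f Pf] [f' Pf'] /Rle/= ff' /Rle/= f'f.
  apply: eq_exist; apply/funext => x.
  by apply/eqP; rewrite eq_le ff' f'f.
- move=> A Atot; have [[f0 Af0]|A0] := pselect (A !=set0); last first.
    (* The empty chain is bounded by [g] itself. *)
    by exists g0 => f Af; case: A0; exists f.
  have [t tP] := choice (fun x => B_complete [set sval f x | f in A]).
  have At f x : A f -> sval f x <= t x by move=> Af; apply: (tP x).1; exists f.
  (* The pointwise supremum of a chain preserves meets: of two members one dominates, and its value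
     at the meet bounds the meet of their values. *)
  have tH : meet_hom t.
    split; first last.
    + move=> x y; apply/eqP; rewrite eq_le; apply/andP; split.
        apply: (tP _).2 => _ [f Af <-]; have [[_ _ fM] _] := svalP f.
        by rewrite fM leI2 ?At.
      apply: (supremums_meet_le (tP x) (tP y)) => _ _ [f Af <-] [f' Af' <-].
      have [/Rle ff'|/Rle f'f] := Atot _ _ Af Af'.
        have [[_ _ f'M] _] := svalP f'; apply: le_trans (At f' _ Af').
        by rewrite f'M leI2.
      have [[_ _ fM] _] := svalP f; apply: le_trans (At f _ Af).
      by rewrite fM leI2.
    + apply/eqP; rewrite -le1x; apply: le_trans (At f0 _ Af0).
      by have [[_ f1 _] _] := svalP f0; rewrite f1.
    + apply/eqP; rewrite -lex0; apply: (tP _).2 => _ [f Af <-].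
      by have [[f0' _ _] _] := svalP f; rewrite f0'.
  have gt x : g x <= t x.
    by apply: le_trans (At f0 x Af0); have [_] := svalP f0; exact.
  by exists (exist _ t (Logic.conj tH gt)) => f Af; apply/Rle => x; exact: At.
have [r0 r1 rM] := rH; exists r => //; split=> // x.
apply/eqP; rewrite eq_le; apply/andP; split.
  by rewrite -disj_leC -rM meetCx r0.
(* Extending at the complement of [x] gives a map whose value there is at least the complement of
   [r x]; by maximality this map is [r]. *)
have r'H := meet_hom_extend (~` x) rH; rewrite complK in r'H.
set r' := fun _ => _ in r'H.
have rr' y : r y <= r' y.
  by rewrite /r' lexI leUl; apply: meet_hom_le => //; exact: leUr.
have gr' y : g y <= r' y by exact: le_trans (rr' y).
pose t : T := exist _ r' (Logic.conj r'H gr').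
have/(congr1 sval)/= r'r : t = exist _ r (Logic.conj rH gr) by apply/rmax/Rle.
rewrite -[leRHS](congr1 (fun f : C -> B => f _) r'r).
by rewrite /r' joinxC r1 meetx1 leUr.
Qed.
End BooleanHomomorphisms.

(** * Existence of ultrafilters *)

Section Ultrafilters.
Import Order.Theory.
Local Open Scope order_scope.
Variables (d : Order.disp_t) (B : ctbDistrLatticeType d).

(* An ultrafilter is a homomorphism into [bool]. *)
Lemma ultrafilter_exists (b : B) : b != \bot ->
  exists2 W : set B, ultrafilter W & W b.
Proof.
move=> b0.
(* This is the indicator of the principal filter of [b], proper because [b] is nonzero. *)
have gH : meet_hom (fun x : B => b <= x).
  split; [by rewrite lex0 (negbTE b0) | exact: lex1 | exact: lexI].
have [r [[r0 r1 rM] rC] br] := meet_hom_below_bool_hom bool_complete gH.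
exists [set x | r x]; last by move: (br b); rewrite lexx /=; case: (r b).
split=> //=.
- by rewrite r0.
- by move=> x y rx ry; rewrite rM rx ry.
- by move=> x y rx /meet_idPl xy; move: rx; rewrite -xy rM => /andP[].
- by move=> x; rewrite rC; case: (r x); [left|right].
Qed.
End Ultrafilters.

(** * Substitution and satisfaction in ordinary structures *)

Section Satisfaction.
Variable L : language.

Lemma eval_tsubst (S : structure L) (C : Type) (e : C -> S) (n m : nat)
    (s : 'I_n -> term L C m) (v : 'I_m -> S) (t : term L C n) :
  eval e v (tsubst s t) = eval e (fun i => eval e v (s i)) t.
Proof. by elim: t => //= f ts IH; congr fint; apply/funext. Qed.

Lemma eval_tmap (S : structure L) (C D : Type) (h : C -> D) (e : D -> S)
    (n : nat) (v : 'I_n -> S) (t : term L C n) :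
  eval e v (tmap h t) = eval (e \o h) v t.
Proof. by elim: t => //= f ts IH; congr fint; apply/funext. Qed.

Lemma scons_comp (X Y : Type) (f : X -> Y) (n : nat) (x : X) (v : 'I_n -> X) :
  (fun i => f (scons x v i)) = scons (f x) (fun i => f (v i)).
Proof. by apply/funext => i; rewrite /scons; case: (unlift ord0 i). Qed.

Lemma eval_lift_subst (S : structure L) (C : Type) (e : C -> S) (n m : nat)
    (s : 'I_n -> term L C m) (x : S) (v : 'I_m -> S) :
  (fun i => eval e (scons x v) (lift_subst s i)) =
  scons x (fun i => eval e v (s i)).
Proof.
rewrite /lift_subst scons_comp /= /scons unlift_none /=.
apply/funext => i; case: (unlift ord0 i) => //= j.
by rewrite eval_tsubst /=; congr eval; apply/funext => k; rewrite liftK.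
Qed.

Lemma sat_fsubst (S : structure L) (C : Type) (e : C -> S) (n : nat)
    (phi : formula L C n) (m : nat) (s : 'I_n -> term L C m) (v : 'I_m -> S) :
  sat e (fsubst phi s) v = sat e phi (fun i => eval e v (s i)).
Proof.
elim: phi m s v =>
  {n} [n t u|n R ts|n phi IH|n phi IH psi IH'|n phi IH] m s v /=.
- by rewrite !eval_tsubst.
- by congr rint; apply/funext => i; rewrite eval_tsubst.
- by rewrite IH.
- by rewrite IH IH'.
- by congr ex; apply/funext => x; rewrite IH eval_lift_subst.
Qed.

Lemma sat_fmap (S : structure L) (C D : Type) (h : C -> D) (e : D -> S)
    (n : nat) (phi : formula L C n) (v : 'I_n -> S) :
  sat e (fmap h phi) v = sat (e \o h) phi v.
Proof.
elim: phi v => {n} [n t u|n R ts|n phi IH|n phi IH psi IH'|n phi IH] v /=.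
- by rewrite !eval_tmap.
- by congr rint; apply/funext => i; rewrite eval_tmap.
- by rewrite IH.
- by rewrite IH IH'.
- by congr ex; apply/funext => x; rewrite IH.
Qed.

Lemma sat_inst (S : structure L) (C : Type) (e : C -> S) (n : nat)
    (phi : formula L C n.+1) (a : C) (v : 'I_n -> S) :
  sat e (inst phi a) v = sat e phi (scons (e a) v).
Proof. by rewrite /inst sat_fsubst scons_comp. Qed.

(** Boolean values exist for sentences only, so an assignment has to be written into the formula as
    parameters. *)
Definition asg (C : Type) (n : nat) (phi : formula L C n) (v : 'I_n -> C) :
    sentence L C :=
  fsubst phi (fun i => Par L 0 (v i)).

Lemma models_asg (S : structure L) (C : Type) (e : C -> S) (n : nat)
    (phi : formula L C n) (v : 'I_n -> C) :
  models e (asg phi v) = sat e phi (e \o v).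
Proof. exact: sat_fsubst. Qed.

Lemma snil_unique (X : Type) (v : 'I_0 -> X) : v = @snil X.
Proof. by apply/funext => -[]. Qed.

Lemma sat_conj (S : structure L) (C : Type) (e : C -> S) (n : nat)
    (s : seq (formula L C n)) (v : 'I_n -> S) :
  sat e (conj s) v <-> forall phi, phi \in s -> sat e phi v.
Proof.
elim: s => [|psi s IH]; last first.
  split=> [[psiv /IH sv] phi|sv] /=.
    by rewrite inE => /predU1P[->//|]; exact: sv.
  split; first by apply: sv; rewrite mem_head.
  by apply/IH => phi phis; apply: sv; rewrite inE phis orbT.
by split=> // _; have [x] := dom_inhabited S; exists x.
Qed.

Lemma models_exs (S : structure L) (C : Type) (e : C -> S) (n : nat)
    (phi : formula L C n) :
  models e (exs phi) <-> exists v, sat e phi v.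
Proof.
elim: n phi => [|n IH] phi /=.
  split=> [phiv|[v]]; first by exists (@snil S).
  by rewrite (snil_unique v).
rewrite IH; split=> [[v [x xv]]|[v phiv]]; first by exists (scons x v).
exists (v \o lift ord0), (v ord0); congr (sat e phi _): phiv.
by apply/funext => i; rewrite /scons; case: unliftP => [j|] ->.
Qed.

End Satisfaction.

(** * Boolean values and membership in an ultrafilter *)

Section Values.
Import Order.Theory.
Local Open Scope order_scope.
Variables (L : language) (d : Order.disp_t) (B : ctbDistrLatticeType d).
Variable M : full_bvs L B.

(** The axioms speak of valid sentences only, so the implication is coded as the negation of [phi]
    and not [psi]; that this has value 1 is the inequality. *)
Lemma bval_le (phi psi : sentence L M) :
  (forall (S : structure L) (e : M -> S), models e phi -> models e psi) ->
  bval phi <= bval psi.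
Proof.
move=> phipsi.
have : bval (Neg (And phi (Neg psi))) = \top.
  by apply: bval_valid => S e [/= /phipsi psiS]; exact.
rewrite bval_neg bval_and bval_neg => /(congr1 Order.compl).
by rewrite complK compl1 => /eqP; rewrite disj_leC complK.
Qed.

Lemma bval_equiv (phi psi : sentence L M) :
  (forall (S : structure L) (e : M -> S), models e phi <-> models e psi) ->
  bval phi = bval psi.
Proof.
by move=> h; apply/eqP; rewrite eq_le !bval_le // => S e; apply h.
Qed.

Lemma bval_conj (s : seq (sentence L M)) :
  bval (conj s) = \meet_(phi <- s) bval phi.
Proof.
elim: s => [|phi s IH]; last by rewrite big_cons -IH -bval_and.
rewrite big_nil; apply: bval_valid => S e.
by have [x] := dom_inhabited S; exists x.
Qed.

Lemma bval_asg0 (phi : sentence L M) (v : 'I_0 -> M) :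
  bval (asg phi v) = bval phi.
Proof.
by apply: bval_equiv => S e; rewrite models_asg (snil_unique (e \o v)).
Qed.

(** Fullness is applied to the valid sentence saying that some element equals [t]. The witness later
    interprets function symbols in the specialization. *)
Lemma term_witness (t : term L M 0) : exists a, bval (Eq t (Par L 0 a)) = \top.
Proof.
pose phi : formula L M 1 :=
  Eq (tsubst (fun i : 'I_0 => Var L M (lift ord0 i)) t) (Var L M ord0).
have [a phia] := bval_full phi; exists a.
rewrite (@bval_equiv _ (inst phi a)) -?phia.
  apply: bval_valid => S e; exists (eval e (@snil S) t) => /=.
  by rewrite eval_tsubst /= /scons unlift_none (snil_unique (fun _ => _)).
move=> S e; rewrite /models sat_inst /= eval_tsubst /=.
by rewrite /scons unlift_none (snil_unique (fun _ => _)).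
Qed.

Lemma exists_bval_asg (n : nat) (phi : formula L M n.+1) (v : 'I_n -> M) :
  exists a, bval (asg (Ex phi) v) = bval (asg phi (scons a v)).
Proof.
have [a ->] := bval_full (fsubst phi (lift_subst (fun i => Par L 0 (v i)))).
exists a; apply: bval_equiv => S e.
by rewrite models_asg /models sat_inst sat_fsubst eval_lift_subst -scons_comp.
Qed.

Variables (W : set B) (W_ultra : ultrafilter W).

Lemma ultra_meetE (a b : B) : W (a `&` b) <-> W a /\ W b.
Proof.
split=> [Wab|[]]; last exact: ultra_meet.
by split; apply: (ultra_up W_ultra Wab); rewrite ?leIl ?leIr.
Qed.

Lemma ultra_complE (a : B) : W (~` a) <-> ~ W a.
Proof.
split=> [Wca Wa|]; last by case: (ultra_compl W_ultra a).
by apply: (ultra_bot W_ultra); rewrite -(meetxC a); exact: ultra_meet.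
Qed.

Lemma ultra_bigmeet (J : eqType) (s : seq J) (F : J -> B) :
  W (\meet_(i <- s) F i) <-> forall i, i \in s -> W (F i).
Proof.
elim: s => [|j s IH]; first by rewrite big_nil; split=> // _; exact: ultra_top.
rewrite big_cons ultra_meetE IH; split=> [[Wj Ws] i|Ws].
  by rewrite inE => /predU1P[->//|]; exact: Ws.
by split=> [|i si]; apply: Ws; rewrite inE ?eqxx ?si ?orbT.
Qed.

(** Sentences with value in [W] are closed under semantic consequence from finitely many premises,
    which replaces formal derivations below. *)
Lemma ultra_entails (s : seq (sentence L M)) (psi : sentence L M) :
  (forall phi, phi \in s -> W (bval phi)) ->
  (forall (S : structure L) (e : M -> S),
     (forall phi, phi \in s -> models e phi) -> models e psi) ->
  W (bval psi).
Proof.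
move=> /ultra_bigmeet; rewrite -bval_conj => Ws spsi.
by apply: (ultra_up W_ultra Ws); apply: bval_le => S e /sat_conj; exact: spsi.
Qed.

(** The Henkin property: fullness turns a true existential into a true instance. *)
Lemma ultra_asgE (n : nat) (phi : formula L M n.+1) (v : 'I_n -> M) :
  W (bval (asg (Ex phi) v)) <-> exists a, W (bval (asg phi (scons a v))).
Proof.
split=> [|[a Wa]].
  by have [a ->] := exists_bval_asg phi v; exists a.
apply: (ultra_up W_ultra Wa); apply: bval_le => S e; rewrite !models_asg /=.
by exists (e a); rewrite -scons_comp.
Qed.

End Values.

(** * Construction of the specialization *)

Lemma quotient_type (T : Type) (E : T -> T -> Prop) :
  (forall x, E x x) -> (forall x y, E x y -> E y x) ->
  (forall x y z, E x y -> E y z -> E x z) ->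
  exists (Q : Type) (c : T -> Q) (s : Q -> T),
    cancel s c /\ forall x y, c x = c y <-> E x y.
Proof.
move=> Er Es Et; pose Q := {X : set T | exists x, X = E x}.
pose c x : Q := exist _ (E x) (ex_intro _ x erefl).
have cE x y : c x = c y <-> E x y.
  split=> [/(congr1 sval)/= ExEy|xy]; first by rewrite ExEy; exact: Er.
  by apply: eq_exist; apply/predeqP => z; split; apply: Et => //; exact: Es.
(* Chosen representatives allow operations on the quotient to be defined without a prior
   compatibility proof. *)
have /choice[s sP] (q : Q) : exists x, c x = q.
  by case: q => X [x Xx]; exists x; apply: eq_exist.
by exists Q, c, s.
Qed.

(** A Henkin construction: [M] is divided by the equations whose value lies in [W], and the truth
    lemma follows by induction on formulas, with fullness at the quantifier. *)
Lemma specialization_exists (L : language) (d : Order.disp_t)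
    (B : ctbDistrLatticeType d) (M : full_bvs L B) (W : set B) :
  ultrafilter W ->
  exists (S : structure L) (pi : M -> S), is_specialization W pi.
Proof.
move=> W_ultra.
have entW := @ultra_entails L d B M W W_ultra.
have ent2 (phi chi psi : sentence L M) : W (bval phi) -> W (bval chi) ->
    (forall (S : structure L) (e : M -> S),
       models e phi -> models e chi -> models e psi) -> W (bval psi).
  move=> Wphi Wchi phipsi; apply: (entW [:: phi; chi]) => [xi|S e S1].
    by rewrite !inE => /orP[] /eqP ->.
  by apply: phipsi; apply: S1; rewrite !inE eqxx ?orbT.
pose teq (t u : term L M 0) := W (bval (Eq t u)).
have teqr t : teq t t.
  rewrite /teq bval_valid; [exact: ultra_top | by []].
have teqs t u : teq t u -> teq u t.
  by move=> tu; apply: (ent2 _ _ _ tu tu) => S e ut _; exact: esym.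
have teqt t u w : teq t u -> teq u w -> teq t w.
  by move=> tu uw; apply: ent2 tu uw _ => S e; exact: etrans.
have [Q [q [s [sK qE]]]] := @quotient_type M
  (fun a b => teq (Par L 0 a) (Par L 0 b))
  (fun _ => teqr _) (fun _ _ => @teqs _ _) (fun _ _ _ => @teqt _ _ _).
have /choice[tval tvalP] : forall t : term L M 0, exists a, teq t (Par L 0 a).
  by move=> t; have [a ta] := term_witness t; exists a; rewrite /teq ta;
    exact: ultra_top.
have tvalE t u : q (tval t) = q (tval u) <-> teq t u.
  rewrite qE; split=> tu.
    by apply: (teqt _ _ _ (tvalP t)); apply: (teqt _ _ _ tu); apply: teqs.
  by apply: (teqt _ t); [apply: teqs | apply: (teqt _ u)].
(* Finitely many equations true in [W] identify each argument with its chosen representative;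
   congruence for function and relation symbols is then a semantic consequence of them. *)
pose repr_eqs k (ts : 'I_k -> term L M 0) :=
  codom (fun i => Eq (Par L 0 (s (q (tval (ts i))))) (ts i)).
have repr_eqs_true k (ts : 'I_k -> term L M 0) phi :
    phi \in repr_eqs k ts -> W (bval phi).
  case/codomP=> i ->; apply: (teqt _ (Par L 0 (tval (ts i)))); last exact: teqs.
  by apply/qE; rewrite sK.
have eval_repr (S : structure L) (e : M -> S) k (ts : 'I_k -> term L M 0) :
    (forall phi, phi \in repr_eqs k ts -> models e phi) ->
    (fun i => e (s (q (tval (ts i))))) = (fun i => eval e (@snil S) (ts i)).
  by move=> tse; apply/funext => i; exact: (tse _ (codom_f _ i)).
have Q_inh : inhabited Q.
  have [a _] := bval_full (Eq (Var L M ord0) (Var L M ord0)).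
  by exists; exact: q a.
pose S := @Structure L Q Q_inh
  (fun f qs => q (tval (App (fun i => Par L 0 (s (qs i))))))
  (fun r qs => W (bval (Rel (fun i => Par L 0 (s (qs i)))))).
have evalE n (t : term L M n) (v : 'I_n -> M) :
    eval (q : M -> S) (q \o v) t =
    q (tval (tsubst (fun i => Par L 0 (v i)) t)).
  elim: t => [i|a|f ts IH] /=; [by apply/qE..|].
  apply/tvalE.
  pose us i := tsubst (fun j => Par L 0 (v j)) (ts i).
  apply: (entW (repr_eqs _ us)); first exact: repr_eqs_true.
  move=> S' e /eval_repr tse; rewrite /models /= -tse; congr fint.
  by apply/funext => i; rewrite IH.
have relE (r : rsym L) (ts : 'I_(rarity r) -> term L M 0) :
    W (bval (Rel (fun i => Par L 0 (s (q (tval (ts i))))))) <->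
    W (bval (Rel ts)).
  split=> Wr; apply: (entW (_ :: repr_eqs _ ts));
    try (by move=> phi; rewrite inE => /predU1P[->|];
      [exact: Wr | exact: repr_eqs_true]).
  - move=> S' e tse; rewrite /models /= -eval_repr.
      exact: (tse _ (mem_head _ _)).
    by move=> phi phiE; apply: tse; rewrite inE phiE orbT.
  - move=> S' e tse; rewrite /models /= eval_repr.
      exact: (tse _ (mem_head _ _)).
    by move=> phi phiE; apply: tse; rewrite inE phiE orbT.
have satE n (phi : formula L M n) (v : 'I_n -> M) :
    sat (q : M -> S) phi (q \o v) <-> W (bval (asg phi v)).
  elim: phi v => {n} [n t u|n r ts|n phi IH|n phi IH psi IH'|n phi IH] v /=.
  - by rewrite !evalE tvalE.
  - pose w i := eval (q : M -> S) (q \o v) (ts i).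
    rewrite -[X in X <-> _]/(W (bval (Rel (fun i => Par L 0 (s (w i)))))).
    by rewrite (funext (fun i => evalE _ (ts i) v : w i = _)); exact: relE.
  - by rewrite IH /asg /= bval_neg ultra_complE.
  - by rewrite IH IH' /asg /= bval_and ultra_meetE.
  - rewrite ultra_asgE //; split=> [[x xv]|[a av]].
      exists (s x); apply/IH; congr (sat _ _ _): xv.
      by rewrite /comp scons_comp sK.
    exists (q a); move/IH: av; congr (sat _ _ _).
    by rewrite /comp scons_comp.
exists S, q; split; first by move=> x; exists (s x); exact: sK.
move=> phi; rewrite -(bval_asg0 phi (@snil M)) -satE.
by rewrite /models (snil_unique (q \o _)).
Qed.

(** * Full Boolean-valued reduced products *)

Section ReducedProduct.
Import Order.Theory.
Local Open Scope order_scope.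
Variables (L : language) (d : Order.disp_t) (B : ctbDistrLatticeType d).
Variables (I : Type) (S_ : I -> structure L) (r : set I -> B).
Hypothesis r_hom : bool_hom r.

Let rT : r setT = \top. Proof. by case: r_hom => -[]. Qed.
Let rI (X Y : set I) : r (X `&` Y)%classic = r X `&` r Y.
Proof. by case: r_hom => -[_ _ rM] _; exact: rM. Qed.
Let rC (X : set I) : r (~` X)%classic = ~` r X.
Proof. by case: r_hom => _ rC; exact: rC. Qed.
Let rS (X Y : set I) : X `<=` Y -> r X <= r Y.
Proof.
by case: r_hom => rH _ XY; apply: meet_hom_le => //; apply/subsetPset.
Qed.

(** Calculation modulo sets of value 1 becomes [near] reasoning for this filter. *)
Let F : set_system I := [set X | r X = \top].

#[local] Instance F_filter : Filter F.
Proof.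
split; [exact: rT | by move=> X Y FX FY; rewrite /F /= rI FX FY meetxx|].
by move=> X Y XY FX; apply/eqP; rewrite -le1x -FX; exact: rS.
Qed.

(** Intersecting either set with the agreement set, of value 1, leaves its value unchanged and makes
    the two sets coincide. *)
Let near_eq (X Y : set I) : (\forall i \near F, X i = Y i) -> r X = r Y.
Proof.
move=> XY; have rXD (Z : set I) : r Z = r (Z `&` [set i | X i = Y i])%classic.
  by rewrite rI [X in _ `&` X](XY : r _ = _) meetx1.
rewrite rXD [RHS]rXD; congr r; apply/predeqP => i /=.
by split=> -[Zi XYi]; split=> //; [rewrite -XYi | rewrite XYi].
Qed.

(** A filter is closed under finite intersections, and the index type ['I_k] is finite. *)
Let near_fun (k : nat) (T : I -> Type) (f g : forall i, 'I_k -> T i) :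
  (forall j, \forall i \near F, f i j = g i j) -> \forall i \near F, f i = g i.
Proof.
move=> fgj; have fg := filter_forall F_filter fgj.
by near=> i; apply/funext; near: i; exact: fg.
Unshelve. all: by end_near. Qed.

Let near_eval (C : Type) (e e' : forall i, C -> S_ i) (n : nat)
    (t : term L C n) :
  (forall a, \forall i \near F, e i a = e' i a) ->
  \forall i \near F, forall v, eval (e i) v t = eval (e' i) v t.
Proof.
move=> ee'; elim: t => [j|a|f ts IH] /=; first exact: nearW.
  by near=> i => v; near: i; exact: ee'.
have {}IH := filter_forall F_filter IH.
near=> i => v; congr fint; apply/funext => j.
by move: j v; near: i.
Unshelve. all: by end_near. Qed.

Let near_sat (C : Type) (e e' : forall i, C -> S_ i) (n : nat)
    (phi : formula L C n) :
  (forall a, \forall i \near F, e i a = e' i a) ->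
  \forall i \near F, forall v, sat (e i) phi v = sat (e' i) phi v.
Proof.
move=> ee'; elim: phi =>
  {n} [n t u|n R ts|n phi IH|n phi IH psi IH'|n phi IH] /=.
- have t_ := near_eval t ee'; have u_ := near_eval u ee'.
  by near=> i => v; congr (_ = _); move: v; near: i.
- have ts_ := filter_forall F_filter (fun j => near_eval (ts j) ee').
  near=> i => v; congr rint; apply/funext => j.
  by move: j v; near: i.
- by near=> i => v; congr (~ _); move: v; near: i.
- by near=> i => v; congr (_ /\ _); move: v; near: i.
- near=> i => v; congr ex; apply/funext => x.
  by move: (scons x v); near: i.
Unshelve. all: by end_near. Qed.

(* The carrier of [N] is the product modulo equality on a set of [r]-value 1,
   so parameters are only determined up to such a set. *)
Lemma reduced_product :
  exists (N : full_bvs L B) (c : (forall i, S_ i) -> N),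
  forall (C : Type) (g : C -> forall i, S_ i) (n : nat) (phi : formula L C n)
    (v : 'I_n -> forall i, S_ i),
  bval (asg (fmap (c \o g) phi) (c \o v)) =
  r [set i | sat (g^~ i) phi (v^~ i)].
Proof.
pose P := forall i, S_ i; pose ev i (a : P) := a i.
pose E (a b : P) := \forall i \near F, a i = b i.
have [Q [c [s [sK cE]]]] : exists (Q : Type) (c : P -> Q) (s : Q -> P),
    cancel s c /\ forall x y, c x = c y <-> E x y.
  apply: quotient_type; rewrite /E.
  - by move=> a; exact: nearW.
  - by move=> a b ab; near=> i; apply/esym; near: i.
  - by move=> a b b' ab bb'; near=> i; transitivity (b i); near: i.
have scE a : \forall i \near F, s (c a) i = a i by apply/cE; rewrite sK.
pose val (phi : sentence L Q) := r [set i | models (ev i \o s) phi].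
have val_asg C (g : C -> P) n (phi : formula L C n) (v : 'I_n -> P) :
    val (asg (fmap (c \o g) phi) (c \o v)) =
    r [set i | sat (g^~ i) phi (v^~ i)].
  apply: near_eq; have vE := near_fun (fun j => scE (v j)).
  have sE := near_sat phi (fun a => scE (g a)).
  near=> i; rewrite /= models_asg sat_fmap.
  have sEi w : sat (fun a => s (c (g a)) i) phi w = sat (g^~ i) phi w.
    by move: w; near: i.
  by transitivity (sat (g^~ i) phi (fun j => s (c (v j)) i));
    [exact: sEi | congr sat; near: i].
have val_neg phi : val (Neg phi) = ~` val phi by exact: rC.
have val_and phi psi : val (And phi psi) = val phi `&` val psi by exact: rI.
have val_le phi psi :
    (forall i, models (ev i \o s) phi -> models (ev i \o s) psi) ->
    val phi <= val psi by exact: rS.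
have val_full (phi : formula L Q 1) : exists a, val (Ex phi) = val (inst phi a).
  (* Coordinates where the existential fails receive an arbitrary element, so the witnesses form one
     element of the product. *)
  have witness : forall i, exists x : S_ i,
      models (ev i \o s) (Ex phi) ->
      sat (ev i \o s) phi (scons x (@snil (S_ i))).
    move=> i; have [[x xP]|nx] := pselect (models (ev i \o s) (Ex phi)).
      by exists x.
    by have [x] := dom_inhabited (S_ i); exists x.
  pose a i := sval (cid (witness i)); have aP i := svalP (cid (witness i)).
  exists (c a).
  transitivity
    (r [set i | sat (ev i \o s) phi (scons (a i) (@snil (S_ i)))]).
    congr r; apply/predeqP => i /=.
    by split=> [/aP//|ai]; exists (a i).
  apply: near_eq; have aE := scE a.
  near=> i; rewrite /= /models sat_inst /ev /=.
  by congr (sat _ _ (scons _ _)); apply/esym; near: i.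
have val_valid phi : valid phi -> val phi = \top.
  move=> phiv; rewrite -rT; congr r; apply/predeqP => i.
  by split=> // _; exact: phiv.
(* Since [r] may fail to preserve infinite unions, the supremum is obtained as a value attained
   through [val_full]. *)
have val_ex (phi : formula L Q 1) :
    supremums (range (fun a => val (inst phi a))) (val (Ex phi)).
  split=> [_ [a _ <-]|b].
    by apply: val_le => i; rewrite {1}/models sat_inst; exists (ev i (s a)).
  by have [a ->] := val_full phi; apply; exists a.
have val_eq (a b : Q) : a <> b -> val (Eq (Par L 0 a) (Par L 0 b)) < \top.
  move=> ab; rewrite lt_neqAle lex1 andbT; apply/eqP => vab; apply: ab.
  by rewrite -(sK a) -(sK b); apply/cE.
by exists (FullBvs val_valid val_neg val_and val_ex val_eq val_full), c.
Unshelve. all: by end_near. Qed.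
End ReducedProduct.

(** * A homomorphism from the power set of pairs back to [B] *)

Section Mixing.
Import Order.Theory.
Local Open Scope order_scope.
Variables (d : Order.disp_t) (B : ctbDistrLatticeType d) (J : choiceType).

Let I := ({W : set B | ultrafilter W} * {fset J})%type.

(** The map [g] sends a set to the supremum of the [b] for which it contains some cylinder
    [cyl b G], and [r] is a homomorphism above [g]. *)
Lemma stone_retraction : complete_lattice B ->
  exists2 r : set I -> B, bool_hom r &
    (forall b, r [set i | sval i.1 b] = b) /\
    forall j, r [set i | j \in i.2] = \top.
Proof.
move=> B_complete.
pose cyl b G : set I := [set i | sval i.1 b /\ (G `<=` i.2)%fset].
have [g gP] := choice (fun X => B_complete [set b | exists G, cyl b G `<=` X]).
have g_ub X b G : cyl b G `<=` X -> b <= g X.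
  by move=> GX; apply: (gP X).1; exists G.
have gH : meet_hom (g : set I -> B).
  split.
  - apply/eqP; rewrite -lex0; apply: (gP _).2 => b [G G0].
    (* A nonzero [b] lies in some ultrafilter [W], so the pair of [W] and [G] would belong to the
       empty set. *)
    rewrite lex0; apply: contrapT => /negP/ultrafilter_exists[W W_ultra Wb].
    by apply: (G0 (exist _ W W_ultra, G)).
  - by apply/eqP; rewrite -le1x; apply: (g_ub _ _ fset0).
  (* Two cylinders intersect in the cylinder over the meet of their elements and the union of their
     finite sets. *)
  - move=> X Y; apply/eqP; rewrite eq_le; apply/andP; split.
      apply: (gP _).2 => b [G GXY].
      by rewrite lexI !(g_ub _ _ G) // => i /GXY[].
    apply: (supremums_meet_le (gP X) (gP Y)) => x y [G GX] [G' G'Y].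
    apply: (g_ub _ _ (G `|` G')%fset) => -[W H] [/= Wxy].
    have [Wx Wy] := (ultra_meetE (svalP W) x y).1 Wxy.
    by rewrite fsubUset => /andP[GH G'H]; split; [apply: GX | apply: G'Y].
have [r rH gr] := meet_hom_below_bool_hom B_complete gH.
exists r => //; have rle b : b <= r [set i | sval i.1 b].
  by apply: le_trans (gr _); apply: (g_ub _ _ fset0) => i [].
split=> [b|j]; last first.
  apply/eqP; rewrite -le1x; apply: le_trans (gr _).
  apply: (g_ub _ _ [fset j]%fset) => i [_ /fsubsetP]; apply.
  by rewrite inE.
(* The upper bound comes from the lower bound for the complement of [b], as the sets attached to [b]
   and to its complement are disjoint. *)
apply/eqP; rewrite eq_le rle andbT -[leRHS]complK -disj_leC meetC.
have [[r0 _ rM] _] := rH; rewrite -lex0 -r0.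
apply: le_trans (leI2 (rle _) (lexx _)) _; rewrite -rM.
apply: (meet_hom_le rH.1); apply/subsetPset => i [/= ].
by move=> /(ultra_complE (svalP i.1)).
Qed.

End Mixing.

(** * The two directions of the equivalence *)

Section Realization.
Import Order.Theory.
Local Open Scope order_scope.
Variables (L : language) (d : Order.disp_t) (B : ctbDistrLatticeType d).
Variables (U : set B) (M : full_bvs L B) (n : nat) (p : set (formula L M n)).
Hypothesis U_ultra : ultrafilter U.

Lemma realized_multiplicative_refinement (N : full_bvs L B) (h : M -> N)
    (S : structure L) (pi : N -> S) (b : 'I_n -> S) :
  elementary_inclusion h -> is_specialization U pi ->
  realizes (fmap (pi \o h) @` p) b ->
  exists A : {fset p} -> B,
    [/\ distribution A, multiplicative A, refines A (los_map p)
      & distr_in U A].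
Proof.
move=> [_ hE] [pi_surj piE] pb; have [a ab] := choice (fun j => pi_surj (b j)).
pose c (phi : p) := bval (asg (fmap h (val phi)) a).
have Uc phi : U (c phi).
  apply/piE; rewrite models_asg sat_fmap.
  have := pb _ (imageP _ (set_valP phi)); rewrite sat_fmap.
  by congr (sat _ _ _); apply/funext => j; rewrite /= ab.
pose A (s : {fset p}) := \meet_(phi <- s) c phi.
have UA s : U (A s) by apply/(ultra_bigmeet U_ultra) => phi _; exact: Uc.
exists A; split=> //.
- split=> [s||s t st].
  + rewrite lt0x; apply/eqP => As0.
    by apply: (ultra_bot U_ultra); rewrite -As0.
  + by rewrite /A big_seq_fset0.
  + apply/meetsP_seq => phi phis _.
    by apply: meets_inf_seq (fsubsetP st _ phis) _.
- by move=> s; apply: eq_bigr => phi _; rewrite /A big_seq_fset1.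
(* By elementarity the Łoś map can be computed in [N], where the tuple [a] witnesses the
   existential. *)
- move=> s; rewrite /los_map -hE /A /c.
  rewrite -(big_map (fun phi => asg (fmap h (val phi)) a) xpredT
    (fun psi => bval psi)).
  rewrite -bval_conj; apply: bval_le => S' e /sat_conj sat_s.
  rewrite /models sat_fmap; apply/models_exs; exists (e \o a).
  apply/sat_conj => _ /mapP[phi phis ->].
  have := sat_s _ (map_f _ phis).
  by rewrite -/(models e _) models_asg sat_fmap.
Qed.

Lemma multiplicative_refinement_realized (A : {fset p} -> B) :
  complete_lattice B -> multiplicative A -> refines A (los_map p) ->
  distr_in U A ->
  exists (N : full_bvs L B) (h : M -> N),
    elementary_inclusion h /\
    exists (S : structure L) (pi : N -> S),
      is_specialization U pi /\
      exists b : 'I_n -> S, realizes (fmap (pi \o h) @` p) b.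
Proof.
move=> B_complete AM Alos UA.
have spec (W : {W : set B | ultrafilter W}) :=
  cid (specialization_exists M (svalP W)).
pose S_ W := sval (spec W); pose pi_ W := sval (cid (svalP (spec W))).
have piE W phi : sval W (bval phi) <-> models (pi_ W) phi.
  exact: (svalP (cid (svalP (spec W)))).2.
pose I := ({W : set B | ultrafilter W} * {fset p})%type.
have witness (i : I) : exists v : 'I_n -> S_ i.1, forall phi : p,
    phi \in i.2 -> sval i.1 (A [fset phi]%fset) -> sat (pi_ i.1) (val phi) v.
  (* Multiplicativity enters here: since [W] contains each [A [fset phi]] with [phi] in [G], it
     contains [A G], hence the value of the Łoś map at [G]. *)
  pose G := [fset phi in i.2 | `[< sval i.1 (A [fset phi]%fset) >]]%fset.
  have /piE/models_exs[v /sat_conj vG] : sval i.1 (los_map p G).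
    apply: (ultra_up (svalP i.1) _ (Alos G)); rewrite AM.
    apply/(ultra_bigmeet (svalP i.1)) => phi.
    by rewrite !inE => /andP[_ /asboolP].
  exists v => phi phii Aphi; apply: vG; apply: map_f.
  by rewrite !inE phii; apply/asboolP.
have [r rH [rstone rcone]] := stone_retraction p B_complete.
have [N [c cE]] := reduced_product (fun i : I => S_ i.1) rH.
pose j (m : M) (i : I) := pi_ i.1 m.
pose v k (i : I) := sval (cid (witness i)) k.
have vP (i : I) := svalP (cid (witness i)).
(* The set of coordinates satisfying [phi] consists of the pairs whose ultrafilter contains the
   value of [phi], and [r] maps it back to that value. *)
have hE phi : bval (fmap (c \o j) phi) = bval phi.
  rewrite -(bval_asg0 _ (c \o @snil _)) cE -[RHS]rstone; congr r.
  apply/predeqP => i /=; rewrite piE /models.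
  by rewrite (snil_unique (fun _ => _)).
exists N, (c \o j); split.
  split=> // m m' mm'; apply: contrapT => /bval_eq.
  rewrite -hE bval_valid ?ltxx // => S e.
  by rewrite /models /=; move: mm' => /= ->.
have [S [pi piP]] := specialization_exists N U_ultra.
exists S, pi; split=> //; exists (pi \o (c \o v)) => _ [phi pphi <-].
rewrite sat_fmap.
have: U (bval (asg (fmap (c \o j) phi) (c \o v))).
  (* At pairs with [A [fset phi']] in [W] and [phi'] in the finite set, [v] satisfies [phi]. The
     second condition has value 1 under [r], which leaves [A [fset phi']] as a lower bound. *)
  pose phi' : p := SigSub (mem_set pphi).
  apply: (ultra_up U_ultra (UA [fset phi']%fset)).
  rewrite cE -[leLHS]rstone -[leLHS]meetx1 -(rcone phi').
  have [[_ _ rM] _] := rH; rewrite -rM; apply: (meet_hom_le rH.1).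
  apply/subsetPset => i [Ai phii]; exact: (vP i phi').
by move=> /piP.2; rewrite models_asg sat_fmap.
Qed.
End Realization.

Theorem theorem4p8 (L : language) (T : theory L) (d : Order.disp_t)
    (B : ctbDistrLatticeType d) (U : set B) (M : full_bvs L B)
    (n : nat) (p : set (formula L M n))
    (T_complete : complete_theory T)
    (B_complete : complete_lattice B)
    (U_ultra : ultrafilter U)
    (M_T : bv_models M T)
    (p_type : partial_type p) :
  (exists (N : full_bvs L B) (h : M -> N),
     elementary_inclusion h /\
     exists (S : structure L) (pi : N -> S),
       is_specialization U pi /\
       exists b : 'I_n -> S, realizes (fmap (pi \o h) @` p) b)
  <->
  (exists A : {fset p} -> B,
     [/\ distribution A, multiplicative A, refines A (los_map p)
       & distr_in U A]).
Proof.
split=> [[N [h [hE [S [pi [piE [b pb]]]]]]]|[A [_ AM Alos UA]]].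
  exact: (realized_multiplicative_refinement U_ultra hE piE pb).
exact: (multiplicative_refinement_realized U_ultra B_complete AM Alos UA).
Qed.
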